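(* For $d\ge 1$ let $M_d$ be the maximal cardinality of a neighborly $d$-code without twin pairs. Then $$\lim_{d\rightarrow\infty}\left(2^{d}-M_d\right)=\infty .$$
   Context: Let $A=\{0,1,*\}$, and for a positive integer $n$ let $A^n$ be the set of all words $v=v_1\ldots v_n$ with $v_i\in A$ for $i\in[n]=\{1,\ldots,n\}$. For $v\in A^n$ put $\operatorname{prop}(v)=\{i\in[n]\colon v_i\neq *\}$. Two words $v,u\in A^n$ are dichotomous at the $i$-th position if $v_i,u_i\in\{0,1\}$ and $v_i+u_i=1$; they are dichotomous if this holds for some $i\in[n]$, and neighborly if there is precisely one such $i$. Two neighborly words $v,w\in A^n$, with $i$ the unique position at which they are dichotomous, form a twin pair if $w_j=v_j$ for all $j\in[n]\setminus\{i\}$. A set $V\subset A^n$ is a code if every two distinct words in $V$ are dichotomous, and a neighborly code if every two distinct words in $V$ are neighborly. For an integer $d\ge 1$, a code $V\subset A^n$ is a $d$-code if $|\operatorname{prop}(v)|=d$ for every $v\in V$; a neighborly $d$-code is a $d$-code which is a neighborly code. ''Without twin pairs'' means that no two words of $V$ form a twin pair. In the definition of $M_d$ the maximum is taken over all neighborly $d$-codes $V\subset A^n$ without twin pairs, where the length $n$ is an arbitrary positive integer (every $d$-code has at most $2^d$ words, so $M_d$ is well defined). *)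

(* Defs.v *)
From HB Require Import structures.
From mathcomp Require Import all_boot all_order all_algebra.
From mathcomp Require Import all_classical all_reals all_analysis.

Set Implicit Arguments.
Unset Strict Implicit.
Unset Printing Implicit Defensive.

(* The alphabet {0, 1, *}: [Some false] is 0, [Some true] is 1, [None] is *. *)
Definition letter := option bool.

Definition word (n : nat) := {ffun 'I_n -> letter}.

Definition prop_set n (v : word n) : {set 'I_n} := [set i | v i != None]%SET.

Definition dichotomous_at n (v u : word n) (i : 'I_n) : bool :=
  if (v i, u i) is (Some a, Some b) then (a + b == 1)%N else false.

Definition dichotomous n (v u : word n) : bool :=
  [exists i, dichotomous_at v u i].

Definition neighborly n (v u : word n) : bool :=
  #|[set i | dichotomous_at v u i]%SET| == 1.

Definition twin_pair n (v w : word n) : bool :=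
  neighborly v w &&
  [exists i, dichotomous_at v w i && [forall j, (j != i) ==> (w j == v j)]].

Definition code n (V : {set word n}) : Prop :=
  {in V &, forall v u, v != u -> dichotomous v u}.

Definition neighborly_code n (V : {set word n}) : Prop :=
  {in V &, forall v u, v != u -> neighborly v u}.

Definition d_code (d n : nat) (V : {set word n}) : Prop :=
  code V /\ {in V, forall v, #|prop_set v| = d}.

Definition neighborly_d_code (d n : nat) (V : {set word n}) : Prop :=
  d_code d V /\ neighborly_code V.

Definition without_twin_pairs n (V : {set word n}) : Prop :=
  {in V &, forall v w, ~~ twin_pair v w}.

Definition attainable (d k : nat) : Prop :=
  exists n (V : {set word n}),
    [/\ 0 < n, neighborly_d_code d V, without_twin_pairs V & #|V| = k].

Lemma attainable0 d : attainable d 0.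
Proof.
exists 1%N, finset.set0; split; rewrite ?cards0 //; [split; first split|];
  by move=> v; rewrite ?inE // => ?; rewrite inE.
Qed.

(* The binary words obtained from [v] by replacing each * by 0 or 1. *)
Definition box n (v : word n) : {set {ffun 'I_n -> bool}} :=
  [set x in family (fun i => [pred b | (v i == None) || (v i == Some b)])]%SET.

Lemma card_box n (v : word n) : #|box v| * 2 ^ #|prop_set v| = 2 ^ n.
Proof.
rewrite cardsE card_family foldrE big_image /=.
have -> : 2 ^ #|prop_set v| = \prod_(i < n) (if v i != None then 2 else 1).
  by rewrite -big_mkcond /= -sum1_card expn_sum; apply: eq_bigl => i; rewrite inE.
rewrite -big_split /= -[in RHS](card_ord n) -sum1_card expn_sum.
apply: eq_bigr => i _; case: (v i) => [b|] /=.
  by rewrite -[2 in RHS]mul1n; congr (_ * _); rewrite -(card1 b); apply: eq_card => c;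
     rewrite !inE eq_sym.
by rewrite muln1 -card_bool; apply: eq_card.
Qed.

Lemma box_disjoint n (v u : word n) x :
  dichotomous v u -> x \in box v -> x \in box u -> False.
Proof.
case/existsP=> i; rewrite /dichotomous_at !inE => D /familyP/(_ i) + /familyP/(_ i).
by move: D; case: (v i) (u i) (x i) => [[]|] // [[]|] // [].
Qed.

Lemma card_d_code d n (V : {set word n}) : d_code d V -> #|V| <= 2 ^ d.
Proof.
case=> cV dV; rewrite -(leq_pmul2l (_ : 0 < 2 ^ n)) ?expn_gt0 //.
have -> : 2 ^ n * #|V| = (\sum_(v in V) #|box v|) * 2 ^ d.
  rewrite mulnC -sum_nat_const big_distrl /=; apply: eq_bigr => v vV.
  by rewrite -(card_box v) dV.
rewrite leq_mul2r; apply/orP; right.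
under eq_bigr do rewrite -sum1_card big_mkcond /=.
rewrite exchange_big /=.
have -> : 2 ^ n = \sum_(x : {ffun 'I_n -> bool}) 1.
  by rewrite sum1_card card_ffun card_bool card_ord.
apply: leq_sum => x _; rewrite -big_mkcondr sum1_card.
apply/card_le1_eqP => v u /andP[vV xv] /andP[uV xu].
by apply/eqP/negPn/negP => uv; apply: (box_disjoint (cV u v uV vV uv) xu xv).
Qed.

Lemma attainable_ex d : exists k, `[< attainable d k >].
Proof. by exists 0; apply/asboolP/attainable0. Qed.

Lemma attainable_ub d k : `[< attainable d k >] -> k <= 2 ^ d.
Proof. by move=> /asboolP[n [V [_ [dV _] _ <-]]]; exact: card_d_code dV. Qed.

Definition M (d : nat) : nat := ex_maxn (attainable_ex d) (@attainable_ub d).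

Lemma M_attainable d : attainable d (M d).
Proof. by rewrite /M; case: ex_maxnP => k /asboolP. Qed.

Lemma attainable_le_M d k : attainable d k -> k <= M d.
Proof. by rewrite /M; case: ex_maxnP => j _ jmax dk; apply/jmax/asboolP. Qed.

(* Main.v *)
From Pilot Require Import Defs.
From mathcomp Require Import all_boot all_order all_algebra.
From mathcomp Require Import all_classical all_reals all_analysis.
From mathcomp Require Import zify ring.
(* MathComp-Analysis also has a [code]. *)
Import Pilot.Defs.

Import GRing.Theory Num.Theory.
Import numFieldNormedType.Exports.

(* Fix a neighborly [d]-code [V] without twin pairs and let [U] be the set of binary
   words covered by no box. If, at a position [i] used by [V], the boxes with 0 and
   those with 1 had mirror-image unions, then one finds, inside one of the two
   sides, a smaller code with the same property, and in the end a twin pair. Hence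
   every used position exposes part of [U]: a proportion at least [2^-(d+t)] of the
   cube, where [t] is the size of the smaller side. By Graham-Pollak there are at
   least [|V| - 1] used positions, while the sizes of their sides sum to [d |V|];
   so about [|V| / 3] of them have [t <= 3d/4]. On the other hand each point of [U]
   is exposed in at most [2d] directions. Comparing, [2^d - |V|] is at least of
   order [2^(d/4) / d]. *)

Set Implicit Arguments.
Unset Strict Implicit.
Unset Printing Implicit Defensive.

Section Codes.
Variable n : nat.
Implicit Types (v u w : word n) (i j : 'I_n) (x y z : {ffun 'I_n -> bool}).
Implicit Types V W : {set word n}.

(** * Letters, boxes and reflections of the cube *)

Lemma dichotomous_atP v u i :
  reflect (exists b, v i = Some b /\ u i = Some (~~ b)) (dichotomous_at v u i).
Proof.
rewrite /dichotomous_at; apply: (iffP idP) => [|[b [-> ->]]]; last by case: b.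
by case: (v i) => [a|] //; case: (u i) => [b|] // ab; exists a; case: a b ab => [] [].
Qed.

Lemma in_boxP v x : reflect (forall i b, v i = Some b -> x i = b) (x \in box v).
Proof.
rewrite inE; apply: (iffP familyP) => [xv i b vi|xv i].
  by have := xv i; rewrite inE vi /= => /eqP[].
by rewrite inE; case vi: (v i) => [b|] //=; rewrite (xv i b vi).
Qed.

Definition flip i x : {ffun 'I_n -> bool} :=
  [ffun j => if j == i then ~~ x j else x j].

Lemma flip_eq i x : flip i x i = ~~ x i.
Proof. by rewrite ffunE eqxx. Qed.

Lemma flip_neq i j x : j != i -> flip i x j = x j.
Proof. by rewrite ffunE => /negbTE->. Qed.

Lemma flipK i : involutive (flip i).
Proof. by move=> x; apply/ffunP => j; rewrite !ffunE; case: eqP => //; rewrite negbK. Qed.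

Lemma flipC i j x : flip i (flip j x) = flip j (flip i x).
Proof. by apply/ffunP => k; rewrite !ffunE; case: eqP; case: eqP. Qed.

Lemma flip_box i v x : v i = None -> (flip i x \in box v) = (x \in box v).
Proof.
move=> vi; apply/in_boxP/in_boxP => xv j b vj; have := xv j b vj;
  by rewrite flip_neq //; apply/eqP => ji; rewrite ji vi in vj.
Qed.

Lemma box_nonempty v : exists x, x \in box v.
Proof.
exists [ffun i => if v i is Some b then b else false].
by apply/in_boxP => i b vi; rewrite ffunE vi.
Qed.

Definition covered V : {set {ffun 'I_n -> bool}} := (\bigcup_(v in V) box v)%SET.

Lemma coveredP V x : reflect (exists2 v, v \in V & x \in box v) (x \in covered V).
Proof. exact: bigcupP. Qed.

Lemma code_box_inj V v u x :
  code V -> v \in V -> u \in V -> x \in box v -> x \in box u -> v = u.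
Proof.
move=> cV vV uV xv xu; apply/eqP/negPn/negP => vu.
exact: box_disjoint (cV v u vV uV vu) xv xu.
Qed.

Lemma neighborly_code_code V : neighborly_code V -> code V.
Proof.
move=> nV v u vV uV vu; have := nV v u vV uV vu.
rewrite /neighborly => /cards1P[i E]; apply/existsP; exists i.
by have := set11 i; rewrite -E inE.
Qed.

Lemma neighborly_uniq v u i j :
  neighborly v u -> dichotomous_at v u i -> dichotomous_at v u j -> i = j.
Proof.
rewrite /neighborly => /cards1P[k E] di dj.
have: i \in [set k]%SET by rewrite -E inE.
have: j \in [set k]%SET by rewrite -E inE.
by rewrite !inE => /eqP-> /eqP->.
Qed.

Lemma neighborly_same v u i j b :
  neighborly v u -> v i = Some b -> u i = Some (~~ b) -> j != i ->
  v j != u j -> (v j == None) || (u j == None).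
Proof.
move=> N vi ui ji vuj; case vj: (v j) => [a|] //; case uj: (u j) => [c|] //.
case/eqP: ji; apply: (neighborly_uniq N); apply/dichotomous_atP; last by exists b.
exists a; split=> //; move: vuj; rewrite vj uj.
by case: a {vj}; case: c {uj}.
Qed.

(** * Positions at which a code is mirror-symmetric *)

Definition side V i b : {set word n} := [set v in V | v i == Some b]%SET.

(** The pointwise form of saying that [flip i] exchanges the unions of boxes of the two sides of
    [i]: the letter of [w] at [i] is forced to be opposite to that of [v]. *)
Definition balanced V i := forall v x, v \in V -> v i != None -> x \in box v ->
  exists w, [/\ w \in V, w i != None & flip i x \in box w].

Lemma balanced_opposite V i v x b : balanced V i -> v \in V -> v i = Some b ->
  x \in box v -> exists w, [/\ w \in V, w i = Some (~~ b) & flip i x \in box w].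
Proof.
move=> bV vV vi xv; have [|w [wV wi xw]] := bV v x vV _ xv; first by rewrite vi.
exists w; split=> //; case wi' : (w i) wi => [c|] // _; congr Some.
by move/in_boxP/(_ _ _ wi'): xw; rewrite flip_eq (in_boxP _ _ xv i b vi).
Qed.

(* Two words on one side of [i] differ somewhere at [k]; every word on the other
   side must then have [*] at [k], so the union of that other side, which is the
   mirror image of this one, is invariant under flipping [k]. *)
Lemma balanced_side V i k b u w : neighborly_code V -> balanced V i ->
    u \in side V i b -> w \in side V i b -> dichotomous_at u w k ->
  balanced (side V i b) k.
Proof.
move=> nV bV; rewrite !inE => /andP[uV /eqP ui] /andP[wV /eqP wi].
case/dichotomous_atP => c [uk wk] v x.
rewrite inE => /andP[vV /eqP vi] vk xv.
have ki : k != i by apply/eqP => E; move: uk wk; rewrite E ui wi => -[<-] []; case: (b).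
have [z [zV zi xz]] := balanced_opposite bV vV vi xv.
have zk : z k = None.
  have diff p : p \in V -> p i = Some b -> p != z.
    by move=> _ pi; apply/eqP => E; move: zi; rewrite -E pi => -[]; case: (b).
  have P p e : p \in V -> p i = Some b -> p k = Some e -> z k = Some (~~ e) -> False.
    move=> pV pi pk zk; case/eqP: ki.
    apply: (neighborly_uniq (nV p z pV zV (diff p pV pi)));
      apply/dichotomous_atP; [by exists e|by exists b].
  case zk: (z k) => [e|] //; have [ec|ec] := eqVneq e c.
    by case: (P w (~~ c) wV wi wk); rewrite zk ec negbK.
  by case: (P u c uV ui uk); rewrite zk; congr Some; case: e c ec {zk uk wk} => [] [].
have xz' : flip k (flip i x) \in box z by rewrite flip_box.
have [v' [v'V v'i]] := balanced_opposite bV zV zi xz'.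
rewrite -flipC flipK negbK in v'i * => xv'.
exists v'; split=> //; first by rewrite inE v'V v'i eqxx.
(* If [v'] had [*] at [k], its box would contain [x], so [v'] would be [v], which uses [k]. *)
apply/negP => /eqP v'k; rewrite flip_box // in xv'.
by move: vk; rewrite (code_box_inj (neighborly_code_code nV) vV v'V xv xv') v'k.
Qed.

(** Induction on the size of the code: a balanced position in use makes one of its sides, a smaller
    code, balanced at another position in use. Only a twin pair could stop this descent. *)
Lemma balanced_unused V i v : neighborly_code V -> without_twin_pairs V ->
  balanced V i -> v \in V -> v i = None.
Proof.
have [m] := ubnP #|V|; elim: m V i v => // m IH V i v leVm nV tV bV vV.
case vi: (v i) => [b|] //; exfalso.
have [x xv] := box_nonempty v.
have [u [uV ui _]] := balanced_opposite bV vV vi xv.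
have vu : v != u by apply/eqP => E; move: ui; rewrite -E vi => -[]; case: (b).
have nvu := nV v u vV uV vu.
(* Giving [y] at [j] the letter opposite to that of [q] yields a word [w] other than [q] on the side
   of [q]. The two are dichotomous at some [k], where [balanced_side] makes this side balanced; it
   omits [p], so by induction [q] would not use [k]. *)
have main p q c j e : p \in V -> q \in V -> p i = Some c -> q i = Some (~~ c) ->
    p j = None -> q j = Some e -> False.
  move=> pV qV pi qi pj qj; have [y0 yp0] := box_nonempty p.
  have [y [yp yj]] : exists y, y \in box p /\ y j = ~~ e.
    have [E|E] := eqVneq (y0 j) (~~ e); first by exists y0.
    exists (flip j y0); rewrite flip_box // flip_eq; split=> //.
    by case: (y0 j) e E {qj} => [] [].
  have [w [wV wi yw]] := balanced_opposite bV pV pi yp.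
  have ji : j != i by apply/eqP => E; move: pj; rewrite E pi.
  have qw : q != w.
    apply/eqP => E; move/in_boxP/(_ j e): yw; rewrite -E flip_neq // yj => /(_ qj).
    by case: (e).
  have /existsP[k dk] := neighborly_code_code nV qV wV qw.
  have qS : q \in side V i (~~ c) by rewrite inE qV qi eqxx.
  have wS : w \in side V i (~~ c) by rewrite inE wV wi eqxx.
  have subS r : r \in side V i (~~ c) -> r \in V by rewrite inE => /andP[].
  have /(IH _ k q) : #|side V i (~~ c)| < m.
    apply: leq_trans (_ : #|V| <= m); last by rewrite -ltnS.
    apply: proper_card; apply/properP; split; first by apply/fintype.subsetP.
    by exists p; rewrite // inE pV pi; case: (c).
  move=> H; have /dichotomous_atP[a [qk _]] := dk.
  suff: q k = None by rewrite qk.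
  apply: H => //; last exact: balanced_side nV bV qS wS dk.
    by move=> z1 z2 /subS z1V /subS z2V; apply: nV.
  by move=> z1 z2 /subS z1V /subS z2V; apply: tV.
(* Not being twins, [v] and [u] differ at some further [j], where neighborliness leaves [*] in
   exactly one of them. *)
have := tV v u vV uV; rewrite /twin_pair nvu /= => /existsPn/(_ i).
rewrite negb_and; case/orP=> [/dichotomous_atP[]|]; first by exists b.
case/forallPn=> j; rewrite negb_imply => /andP[ji]; rewrite eq_sym => vuj.
case/orP: (neighborly_same nvu vi ui ji vuj) => /eqP E.
- by case uj: (u j) vuj => [e|]; rewrite E // => _; apply: (main v u b j e).
- case vj: (v j) vuj => [e|]; rewrite E // => _.
  by apply: (main u v (~~ b) j e); rewrite ?negbK.
Qed.

(** * Counting covered points and used positions *)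

(** The boxes of a code are disjoint and each fills the proportion [2^-d] of the cube; the product
    form avoids division. *)
Lemma card_covered d V : code V -> {in V, forall v, #|prop_set v| = d} ->
  #|covered V| * 2 ^ d = #|V| * 2 ^ n.
Proof.
move=> cV dV; rewrite -[RHS]sum_nat_const; under [RHS]eq_bigr => v vV.
  rewrite -(card_box v) (dV v vV); over.
rewrite -big_distrl /=; congr (_ * _)%N.
under [RHS]eq_bigr do rewrite -sum1_card big_mkcond /=.
rewrite exchange_big /= -sum1_card big_mkcond /=; apply: eq_bigr => x _.
rewrite -big_mkcondr sum1_card; apply/esym; case: ifPn => [/coveredP[v vV xv]|xV].
  rewrite -(card1 v); apply: eq_card => u; rewrite -!topredE /=.
  apply/andP/eqP => [[uV xu]|->//]; exact: code_box_inj cV uV vV xu xv.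
apply: eq_card0 => u; apply/negP => /andP[uV xu]; case/negP: xV.
by apply/coveredP; exists u.
Qed.

Definition used V i : {set word n} := [set v in V | v i != None]%SET.

Lemma card_used V i : #|used V i| = #|side V i true| + #|side V i false|.
Proof.
have E : (side V i true :&: side V i false = finset.set0)%SET.
  by apply/finset.setP => v; rewrite !inE; case: (v i) => [[]|]; rewrite ?andbF.
rewrite -cardsUI E cards0 addn0; apply: eq_card => v; rewrite !inE.
by case: (v i) => [[]|]; rewrite ?andbF ?andbT ?orbF.
Qed.

Lemma sum_used d V : {in V, forall v, #|prop_set v| = d} ->
  \sum_i #|used V i| = #|V| * d.
Proof.
move=> dV; rewrite -sum_nat_const.
under eq_bigr do rewrite -sum1_card big_mkcond /=.
rewrite exchange_big /= [RHS]big_mkcond /=; apply: eq_bigr => v _.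
case: ifPn => vV; last by apply: big1 => i _; rewrite inE (negbTE vV).
by rewrite -(dV v vV) -[RHS]sum1_card [RHS]big_mkcond /=; apply: eq_bigr => i _;
  rewrite !inE vV.
Qed.

(** * Uncovered points exposed by a position *)

Definition exposed V i : {set {ffun 'I_n -> bool}} :=
  [set x in ~: covered V | flip i x \in covered (used V i)]%SET.

(** The union of a side has size proportional to its number of words. If the smaller side contained
    the mirror image of the larger, the two would coincide and [i] would be balanced although in
    use. *)
Lemma side_not_covered d V i b v : neighborly_code V -> without_twin_pairs V ->
    {in V, forall v, #|prop_set v| = d} -> v \in V -> v i != None ->
    #|side V i b| <= #|side V i (~~ b)| ->
  exists w x, [/\ w \in side V i (~~ b), x \in box w &
                  flip i x \notin covered (side V i b)].
Proof.
move=> nV tV dV vV vi ab; apply/not_existsP => H.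
have {}H w x : w \in side V i (~~ b) -> x \in box w -> flip i x \in covered (side V i b).
  by move=> wV xw; apply/negPn/negP => xS; apply: (H w); exists x.
have cV := neighborly_code_code nV.
have inS c u : u \in side V i c -> u \in V by rewrite inE => /andP[].
have cS c : #|covered (side V i c)| * 2 ^ d = #|side V i c| * 2 ^ n.
  apply: card_covered; first by move=> u w /inS uV /inS wV; apply: cV.
  by move=> u /inS; apply: dV.
have E : (flip i @: covered (side V i (~~ b)))%SET = covered (side V i b).
  apply/eqP; rewrite eqEcard; apply/andP; split.
    apply/fintype.subsetP => _ /imsetP[x /coveredP[w wS xw] ->]; exact: H xw.
  rewrite card_imset; last by apply: inv_inj; exact: flipK.
  by rewrite -(leq_pmul2r (_ : 0 < 2 ^ d)) ?expn_gt0 // !cS leq_mul2r ab orbT.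
suff bV : balanced V i by rewrite (balanced_unused nV tV bV vV) in vi.
move=> u x uV ui xu; case ui': (u i) ui => [c|] // _.
have uS : u \in side V i c by rewrite inE uV ui' eqxx.
have [cb|cb] := eqVneq c b.
  have : x \in covered (side V i b) by apply/coveredP; exists u; rewrite -?cb.
  rewrite -E => /imsetP[y /coveredP[w + yw] ->]; rewrite flipK inE => /andP[wV /eqP wi].
  by exists w; split=> //; rewrite wi.
have {}cb : c = ~~ b by case: c b cb {ui' uS ab H E} => [] [].
have /coveredP[w + xw] := H u x (ltac:(by rewrite -cb)) xu.
by rewrite inE => /andP[wV /eqP wi]; exists w; split=> //; rewrite wi.
Qed.

(* A point of a box escaping [t] other boxes escapes them together with the whole
   subcube obtained by fixing the [d] coordinates of the box and one coordinate
   for each of the [t] boxes. *)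
Lemma card_exposed d V i v : neighborly_code V -> without_twin_pairs V ->
    {in V, forall v, #|prop_set v| = d} -> v \in V -> v i != None ->
  2 ^ n <= #|exposed V i| * 2 ^ (d + minn #|side V i true| #|side V i false|).
Proof.
move=> nV tV dV vV vi.
have cV := neighborly_code_code nV.
have [b [ab ->]] : exists b, #|side V i b| <= #|side V i (~~ b)| /\
    minn #|side V i true| #|side V i false| = #|side V i b|.
  case: (leqP #|side V i true| #|side V i false|) => H; first by exists true.
  by exists false; split=> //; apply: ltnW.
have [w [x [+ xw xS]]] := side_not_covered nV tV dV vV vi ab.
rewrite inE => /andP[wV /eqP wi].
(* Missing a box means being dichotomous to [flip i x] read as a word without [*]. For words off the
   side, [i] is a dummy value. *)
have jP u : exists j, u \in side V i b -> dichotomous_at u [ffun k => Some (flip i x k)] j.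
  have [uS|] := boolP (u \in side V i b); last by exists i.
  have [/existsP[k dk]|/existsPn nd] := boolP (dichotomous u [ffun k => Some (flip i x k)]).
    by exists k.
  case/negP: xS; apply/coveredP; exists u => //; apply/in_boxP => k c uk.
  apply/eqP/negPn/negP => xk; case/negP: (nd k); apply/dichotomous_atP; exists c.
  by split=> //; rewrite ffunE; congr Some; case: c (flip i x k) xk {uk} => [] [].
have [j Hj] := boolp.choice jP.
pose Q := (prop_set w :|: [set j u | u in side V i b])%SET.
pose s : word n := [ffun k => if k \in Q then Some (flip i x k) else None].
have propS : prop_set s = Q.
  by apply/finset.setP => k; rewrite inE ffunE; case: ifP.
have leQ : #|Q| <= d + #|side V i b|.
  rewrite -(dV w wV); apply: leq_trans (leq_card_setU _ _) _.
  by rewrite leq_add2l leq_imset_card.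
have sub : box s \subset exposed V i.
  apply/fintype.subsetP => z zs.
  have zQ k : k \in Q -> z k = flip i x k.
    by move=> kQ; apply: (in_boxP _ _ zs); rewrite ffunE kQ.
  have zw : flip i z \in box w.
    apply/in_boxP => k c wk; have kQ : k \in Q by rewrite !inE wk.
    have := in_boxP _ _ xw k c wk; rewrite ffunE zQ //.
    by rewrite !ffunE; case: eqP => // _; rewrite negbK.
  rewrite inE; apply/andP; split; last by apply/coveredP; exists w; rewrite // inE wV wi.
  (* A word covering [z] with [*] at [i] would also cover [flip i z], hence be [w]; one using [i]
     lies in [side V i b] and is excluded at [j u]. *)
  rewrite inE; apply/negP => /coveredP[u uV zu].
  have iQ : i \in Q by rewrite !inE wi.
  case ui: (u i) => [c|]; last first.
    rewrite -(flip_box _ ui) in zu.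
    by rewrite (code_box_inj cV uV wV zu zw) wi in ui.
  have cb : c = b.
    rewrite -(in_boxP _ _ zu i c ui) zQ // flip_eq (in_boxP _ _ xw i (~~ b) wi).
    by rewrite negbK.
  have uS : u \in side V i b by rewrite inE uV ui cb eqxx.
  have /dichotomous_atP[e [uj]] := Hj u uS; rewrite ffunE => -[xe].
  have jQ : j u \in Q by rewrite inE; apply/orP; right; apply/imsetP; exists u.
  have := in_boxP _ _ zu (j u) e uj; rewrite zQ // xe; by case: (e).
rewrite -(card_box s) propS; apply: leq_mul; first exact: subset_leq_card.
by rewrite leq_exp2l.
Qed.

(* Say that [i] beats [j] when the word exposing [x] at [i] uses [j]. Two exposing
   words are dichotomous only at [i] or [j], so one of [i], [j] beats the other,
   while each [i] beats at most [d] positions. *)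
Lemma card_exposing d V x : code V -> {in V, forall v, #|prop_set v| = d} ->
  #|[set i | x \in exposed V i]%SET| <= d.*2.
Proof.
move=> cV dV; set T := [set i | _]%SET.
have [f fP] : exists f : 'I_n -> word n, forall i, i \in T ->
    [/\ f i \in V, f i i != None & flip i x \in box (f i)].
  suff /boolp.choice[f fP] : forall i, exists w, i \in T ->
    [/\ w \in V, w i != None & flip i x \in box w] by exists f.
  move=> i.
  have [|iT] := boolP (i \in T); last by exists [ffun=> None].
  rewrite !inE => /andP[_ /coveredP[w + xw]]; rewrite inE => /andP[wV wi].
  by exists w.
(* The relation of beating, including the diagonal since [f i] uses [i]. That [E] and its transpose
   cover the square of [T] gives [#|T| ^ 2 <= 2 * d * #|T|]. *)
pose E := [set p : 'I_n * 'I_n | (p.1 \in T) && (p.2 \in prop_set (f p.1))]%SET.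
have EP i j : ((i, j) \in E) = (i \in T) && (f i j != None).
  by rewrite [LHS]inE /= [X in _ && X]inE.
have cE : #|E| = #|T| * d.
  rewrite -sum_nat_const -sum1_card; under [LHS]eq_bigl => p do rewrite inE.
  rewrite -(pair_big_dep (fun i => i \in T) (fun i j => j \in prop_set (f i))
    (fun _ _ => 1)) /=.
  by apply: eq_bigr => i /fP[iV _ _]; rewrite sum1_card dV.
have sub : finset.setX T T \subset E :|: [set (p.2, p.1) | p in E]%SET.
  apply/fintype.subsetP => -[i j]; rewrite finset.in_setX finset.in_setU EP /= => /andP[iT jT].
  have [iV ii xi] := fP i iT; have [jV jj xj] := fP j jT.
  have [<-|ij] := eqVneq i j; first by rewrite iT ii.
  have nij : f i != f j.
    apply/eqP => E0; case fii: (f i i) ii => [c|] // _.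
    have := in_boxP _ _ xi i c fii; rewrite flip_eq.
    rewrite E0 in fii; have := in_boxP _ _ xj i c fii; rewrite flip_neq // => ->.
    by case: (c).
  have /existsP[k /dichotomous_atP[c [ik jk]]] := cV _ _ iV jV nij.
  have := in_boxP _ _ xi k c ik; have := in_boxP _ _ xj k (~~ c) jk.
  have [ki _ _|ki] := eqVneq k i.
    apply/orP; right; apply/imsetP; exists (j, i) => //=; by rewrite EP jT -ki jk.
  have [kj _ _|kj] := eqVneq k j.
    by apply/orP; left; rewrite iT -kj ik.
  by rewrite !flip_neq // => -> ; case: (c).
have := leq_trans (subset_leq_card sub) (leq_card_setU _ _).
rewrite cardsX => H.
have H2 : #|T| * #|T| <= #|T| * d.*2.
  apply: leq_trans H _; rewrite -addnn mulnDr cE leq_add2l -cE; exact: leq_imset_card.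
case: (posnP #|T|) => [->//|T0]; by rewrite leq_pmul2l in H2.
Qed.

(** * The Graham-Pollak inequality *)

Definition positions V : {set 'I_n} :=
  [set i | [exists v in V, v i != None]]%SET.

End Codes.

(* Graham-Pollak: a vector [c] on [V] orthogonal to [1] and to the indicators of
   the sides [v i = Some false] satisfies
   [0 = (\sum_v c v)^2 = \sum_v c v ^ 2 + 2 * \sum_i c(V_i^0) c(V_i^1) = \sum_v c v ^ 2]. *)
Lemma graham_pollak n (V : {set word n}) :
  neighborly_code V -> #|V| <= #|positions V|.+1.
Proof.
move=> nV; rewrite leqNgt; apply/negP => lt.
pose P := positions V.
pose w (k : 'I_#|V|) : word n := enum_val k.
have wV k : w k \in V by exact: enum_valP.
pose a b i k : rat := (w k i == Some b)%:R%R.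
(* One column for the total sum and one per used position: with more rows than columns, the left
   kernel contains a nonzero [c]. *)
pose A : 'M[rat]_(#|V|, 1 + #|P|) := row_mx (const_mx 1%R)
  (\matrix_(k, l) a false (enum_val l) k)%R.
have /rowV0Pn[c] : kermx A != 0%R.
  rewrite -mxrank_eq0 mxrank_ker subn_eq0 -ltnNge.
  by apply: leq_ltn_trans lt; apply: rank_leq_col.
move/sub_kermxP; rewrite mul_mx_row => /eqP; rewrite row_mx_eq0 => /andP[/eqP c1 /eqP c0].
have sum1 : (\sum_k c 0 k = 0)%R.
  have /matrixP/(_ 0%R 0%R) := c1; rewrite !mxE => E; rewrite -[RHS]E.
  by apply: eq_bigr => k _; rewrite mxE mulr1.
have sum0 i : (\sum_k c 0 k * a false i k = 0)%R.
  have [iP|iP] := boolP (i \in P).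
    have /matrixP/(_ 0%R (enum_rank_in iP i)) := c0; rewrite !mxE => E; rewrite -[RHS]E.
    by apply: eq_bigr => k _; rewrite mxE enum_rankK_in.
  apply: big1 => k _; rewrite /a; case: eqP => [wk|_]; last by rewrite mulr0.
  case/negP: iP; rewrite inE; apply/existsP; exists (w k).
  by rewrite wV wk.
(* [N k l] counts the positions with 0 in [w k] and 1 in [w l], so [N k l + N l k] counts the
   dichotomous positions. *)
pose N k l : rat := (\sum_i a false i k * a true i l)%R.
have sumN : (\sum_k \sum_l c 0 k * c 0 l * N k l = 0)%R.
  transitivity (\sum_i (\sum_k c 0 k * a false i k) * (\sum_l c 0 l * a true i l))%R.
    under [RHS]eq_bigr => i _ do [rewrite mulr_suml; under eq_bigr do rewrite mulr_sumr].
    rewrite [RHS]exchange_big /=; apply: eq_bigr => k _.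
    rewrite [RHS]exchange_big /=; apply: eq_bigr => l _.
    by rewrite mulr_sumr; apply: eq_bigr => i _; ring.
  by apply: big1 => i _; rewrite sum0 mul0r.
have NE k l : (N k l + N l k = (k != l)%:R)%R.
  have -> : (N k l + N l k = #|[set i | dichotomous_at (w k) (w l) i]%SET|%:R)%R.
    rewrite /N -big_split /= -[in RHS]sum1_card [in RHS]big_mkcond natr_sum /=.
    apply: eq_bigr => i _; rewrite inE /a /dichotomous_at.
    by case: (w k i) (w l i) => [[]|] [[]|] //=; rewrite ?mulr0 ?mul0r ?mulr1 ?addr0 ?add0r.
  have [<-|kl] := eqVneq k l.
    rewrite (_ : [set i | _]%SET = finset.set0) ?cards0 //.
    by apply/finset.setP => i; rewrite !inE /dichotomous_at; case: (w k i) => [[]|].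
  have := nV _ _ (wV k) (wV l); rewrite (inj_eq enum_val_inj) => /(_ kl).
  by rewrite /neighborly => /eqP->.
have sq0 : (\sum_k c 0 k ^+ 2 = 0)%R.
  have : ((\sum_k c 0 k) * (\sum_l c 0 l) = \sum_k c 0 k ^+ 2 +
     (\sum_k \sum_l c 0 k * c 0 l * N k l + \sum_k \sum_l c 0 k * c 0 l * N k l))%R.
    rewrite [X in (_ + (_ + X))%R]exchange_big /= -!big_split /= mulr_suml.
    apply: eq_bigr => k _; rewrite -big_split /= mulr_sumr.
    rewrite (bigD1 k) //= [in RHS](bigD1 k) //= addrA; congr (_ + _)%R.
      by rewrite -!mulrDr NE eqxx mulr0 addr0 expr2.
    apply: eq_bigr => l lk; rewrite [(c 0 l * c 0 k)%R]mulrC -mulrDr NE eq_sym lk mulr1 //.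
  by rewrite sum1 sumN mulr0 !addr0.
apply/negP; rewrite negbK; apply/eqP/rowP => k; rewrite mxE.
have /eqP := sq0; rewrite psumr_eq0; last by move=> l _; apply: sqr_ge0.
by move/allP/(_ k (mem_index_enum _)); rewrite /= sqrf_eq0 => /eqP.
Qed.

(** * Comparing the counts *)

(** Double counting of pairs of an uncovered point and a direction exposing it: the uncovered
    proportion of the cube is [(2^d - #|V|) / 2^d], and [card_exposing] bounds the directions. *)
Lemma sum_exposed d n (V : {set word n}) : code V ->
  {in V, forall v, #|prop_set v| = d} ->
  (\sum_i #|exposed V i|) * 2 ^ d <= d.*2 * (2 ^ d - #|V|) * 2 ^ n.
Proof.
move=> cV dV.
have -> : (d.*2 * (2 ^ d - #|V|) * 2 ^ n = d.*2 * #|~: covered V|%SET * 2 ^ d)%N.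
  rewrite -!mulnA; congr (_ * _)%N; rewrite mulnBl -(card_covered cV dV).
  have <- : #|covered V| + #|~: covered V|%SET = 2 ^ n.
    by rewrite cardsC card_ffun card_bool card_ord.
  by rewrite [(2 ^ d * _)%N]mulnC -mulnBl addKn.
rewrite leq_mul2r mulnC -sum_nat_const; apply/orP; right.
under eq_bigr do rewrite -sum1_card big_mkcond /=.
rewrite exchange_big /= [leqRHS]big_mkcond /=; apply: leq_sum => x _.
case: ifPn => xV; last first.
  by rewrite big1 // => i _; rewrite inE (negbTE xV).
apply: leq_trans (card_exposing x cV dV).
rewrite -[leqRHS]sum1_card [leqRHS]big_mkcond /=; apply: eq_leq.
by apply: eq_bigr => i _; rewrite [in RHS]inE.
Qed.

Lemma card_twin_free_code d t n (V : {set word n}) : d_code d V -> neighborly_code V ->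
    without_twin_pairs V -> 3 * d <= 4 * t.+1 -> 0 < d ->
  #|V| <= 3 + 6 * d * (2 ^ d - #|V|) * 2 ^ t.
Proof.
move=> [cV dV] nV tV dt d0.
pose good := [set i in positions V | minn #|side V i true| #|side V i false| <= t]%SET.
pose bad := (positions V :\: good)%SET.
have cP : #|positions V| = #|good| + #|bad|.
  rewrite (cardsD (positions V)) (finset.setIidPr _); last first.
    by apply/fintype.subsetP => i; rewrite inE => /andP[].
  by rewrite subnKC // subset_leq_card //; apply/fintype.subsetP => i; rewrite inE => /andP[].
(* A bad position has at least [t.+1] words on each side. *)
have Hbad : #|bad| * (t.+1).*2 <= #|V| * d.
  rewrite -(sum_used dV) -sum_nat_const big_mkcond /=; apply: leq_sum => i _.
  case: ifPn => //; rewrite !inE card_used negb_and -ltnNge => /andP[/orP[/negP//|] H _].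
  by move: H; lia.
have Hgood : #|good| <= 2 ^ t * (d.*2 * (2 ^ d - #|V|)).
  rewrite -(leq_pmul2r (_ : 0 < 2 ^ n)) ?expn_gt0 //.
  rewrite -(leq_pmul2r (_ : 0 < 2 ^ d)) ?expn_gt0 //.
  have -> : (2 ^ t * (d.*2 * (2 ^ d - #|V|)) * 2 ^ n * 2 ^ d =
      d.*2 * (2 ^ d - #|V|) * 2 ^ n * 2 ^ (d + t))%N by rewrite expnD; ring.
  apply: leq_trans (leq_mul (sum_exposed cV dV) (leqnn _)).
  rewrite [leqRHS]mulnAC leq_mul2r; apply/orP; right.
  rewrite -sum_nat_const big_distrl /= big_mkcond /=; apply: leq_sum => i _.
  case: ifPn => //; rewrite !inE => /andP[/existsP[v /andP[vV vi]] le].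
  apply: leq_trans (card_exposed nV tV dV vV vi) _.
  by rewrite leq_mul2l leq_exp2l // leq_add2l le orbT.
have := graham_pollak nV; rewrite cP.
set D := (2 ^ d - #|V|) in Hgood *; move: Hgood Hbad.
set e := 2 ^ t; move: #|good| #|bad| #|V| => g b m Hg Hb mb.
(* By [dt], a bad position is used by at least [3 * d / 2] words. So at least a third of [m], up to
   the one lost in Graham-Pollak, is left to the good positions. *)
have Hb' : 3 * b <= 2 * m.
  rewrite -(leq_pmul2r d0); nia.
have -> : (6 * d * D * e = 3 * (e * (d.*2 * D)))%N by rewrite -mul2n; ring.
lia.
Qed.

Lemma deficiency_lower_bound d : 0 < d ->
  2 ^ (d %/ 4) <= 7 * d * (2 ^ d - M d) + 3.
Proof.
move=> d0; have [n [V [_ [dV nV] tV <-]]] := M_attainable d.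
have leV := card_d_code dV.
(* This [t] satisfies [3 * d <= 4 * t.+1], and [2 ^ d] is [2 ^ t] times [2 ^ (d %/ 4)]. Replacing
   [#|V|] by [2 ^ d - D] and absorbing the extra [D] turns 6 into 7; then [2 ^ t] cancels. *)
pose t := d - d %/ 4.
have := @card_twin_free_code d t n V dV nV tV (ltac:(rewrite /t; lia)) d0.
have E : 2 ^ d = (2 ^ t * 2 ^ (d %/ 4))%N by rewrite -expnD subnK // leq_div.
have : 0 < 2 ^ t by rewrite expn_gt0.
move: leV E; set D := 2 ^ d - #|V| => leV E.
have : 2 ^ d = D + #|V| by rewrite subnK.
rewrite E; move: (2 ^ t) (2 ^ (d %/ 4)) => e q Eq e0 H.
rewrite -(leq_pmul2l e0) Eq.
have DX : D <= e * (d * D) by rewrite mulnA leq_pmull // muln_gt0 e0.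
have -> : (e * (7 * d * D + 3) = 7 * (e * (d * D)) + 3 * e)%N by ring.
have : 6 * d * D * e = (6 * (e * (d * D)))%N by ring.
lia.
Qed.

Lemma deficiency_unbounded k : exists d0, forall d, d0 <= d -> k <= 2 ^ d - M d.
Proof.
have sq q : 4 <= q -> q * q <= 2 ^ q.
  elim: q => // q IH; rewrite leq_eqVlt => /orP[/eqP<-//|q4].
  by have := IH q4; rewrite expnS; nia.
(* With [q = d %/ 4] one has [d <= 8 * q], so a deficiency below [k] bounds the right side by
   [56 * k * q + 3]. This is less than [q * q] once [q >= 56 * k + 8]; the 8 absorbs the 3 and
   ensures [q >= 4]. *)
exists (4 * (56 * k + 8)) => d dk.
have d0 : 0 < d by lia.
have := deficiency_lower_bound d0; rewrite leqNgt => H; rewrite leqNgt.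
apply: contra H => Dk; set q := d %/ 4.
have q4 : 56 * k + 8 <= q by rewrite /q; lia.
apply: leq_trans (sq q _); last lia.
have dq : d <= 8 * q by rewrite /q; lia.
move: Dk; move: (2 ^ d - M d) => D Dk.
have : d * D <= 8 * q * k by apply: leq_mul => //; apply: ltnW.
nia.
Qed.

Local Open Scope classical_set_scope.
Local Open Scope ring_scope.

Theorem theorem2 (R : realType) :
  (2 ^+ d - (M d)%:R : R) @[d --> \oo] --> +oo.
Proof.
apply/cvgryPge => A; have [d0 Hd0] := deficiency_unbounded (Num.truncn A).+1.
near=> d.
have dd : (d0 <= d)%N by near: d; exact: nbhs_infty_ge.
(* This bound makes the truncated subtraction of naturals agree with subtraction in [R]. *)
have leM : (M d <= 2 ^ d)%N.
  by apply: (attainable_ub (d := d)); apply/asboolP/M_attainable.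
rewrite -natrX -natrB //.
apply: Order.POrderTheory.le_trans (Order.POrderTheory.ltW (truncnS_gt A)) _.
by rewrite ler_nat Hd0.
Unshelve. all: by end_near.
Qed.
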